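(* Let $(E,[-,-],a,\mathsf{D})$ be a Loday algebroid over a manifold $M$. Then $(E,[-,-],a)$ is a symmetric Leibniz algebroid if and only if, for all $f\in C^\infty(M)$ and all $X,Y,Z\in\Gamma E$, $$(\mathsf{D}f)(X,Y)=(\mathsf{D}f)(Y,X)$$ and $$(\mathsf{D}f)(X,[Y,Z]+[Z,Y])=(\mathsf{D}f)([X,Y],Z)+(\mathsf{D}f)(Y,[X,Z]).$$
   Context: Manifolds are finite-dimensional, smooth, second-countable and Hausdorff. A (left) Leibniz bracket is an $\mathbb{R}$-bilinear bracket with $[X,[Y,Z]]=[[X,Y],Z]+[Y,[X,Z]]$, and $X\circ Y:=[X,Y]+[Y,X]$ is its symmetrization. A Leibniz algebroid over $M$ is a vector bundle $E\to M$ with a vector bundle morphism $a:E\to TM$ (the anchor; also denoted $a:\Gamma E\to\Gamma TM$ on sections) and a Leibniz bracket $[-,-]$ on $\Gamma E$ such that $[X,fY]=f[X,Y]+a(X)(f)Y$ for all $f\in C^\infty(M)$, $X,Y\in\Gamma E$. (It follows that $a[X,Y]=[a(X),a(Y)]$.) A Loday algebroid is a Leibniz algebroid $(E,[-,-],a)$ equipped with a derivation $\mathsf{D}:C^\infty(M)\to\mathrm{Hom}_{C^\infty(M)}(\Gamma(E^{\otimes2}),\Gamma E)$ such that $[fX,Y]=f[X,Y]-a(Y)(f)X+(\mathsf{D}f)(X,Y)$ for all $X,Y\in\Gamma E$, $f\in C^\infty(M)$. A symmetric Leibniz algebroid is a Leibniz algebroid $(E,[-,-],a)$ over $M$ such that,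 for all $f\in C^\infty(M)$ and $X,Y,Z\in\Gamma E$: $X\circ fY-(fX)\circ Y=0$ and $[fX,Y\circ Z]-[X,Y]\circ fZ-(fY)\circ[X,Z]=0$. *)

(* Defs.v *)
From HB Require Import structures.
From mathcomp Require Import all_boot all_order all_algebra.
From mathcomp Require Import all_classical all_reals all_analysis.
Set Implicit Arguments.
Unset Strict Implicit.
Unset Printing Implicit Defensive.
Import Order.TTheory GRing.Theory Num.Theory.
Import numFieldNormedType.Exports.
Local Open Scope classical_set_scope.
Local Open Scope ring_scope.

(* A function on an open set is smooth when all its iterated directional
   derivatives are (Frechet) differentiable at every point of the set.
   [smooth_on U] is only used for open sets [U]. *)
Fixpoint times_differentiable (R : realType) (m : nat) (W : normedModType R)
    (k : nat) (f : 'rV[R]_m -> W) (x : 'rV[R]_m) : Prop :=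
  if k is k'.+1 then
    differentiable f x /\ forall v, times_differentiable k' ('D_v f) x
  else True.

Definition smooth_on (R : realType) (m : nat) (W : normedModType R)
    (U : set 'rV[R]_m) (f : 'rV[R]_m -> W) : Prop :=
  forall k x, U x -> times_differentiable k f x.

Section Calculus.
Variable (R : realType).

Lemma near_open m (U : set 'rV[R]_m) (P : 'rV[R]_m -> Prop) x :
  open U -> U x -> (forall y, U y -> P y) -> \forall y \near x, P y.
Proof.
move=> oU Ux H; have : nbhs x U by exact: open_nbhs_nbhs.
exact: filterS.
Qed.

Lemma near_derive m (W : normedModType R) (f g : 'rV[R]_m -> W) x v :
  (\near x, f x = g x) -> 'D_v f x = 'D_v g x.
Proof.
move=> fg; case: (eqVneq v 0) => [->|v0]; first by rewrite !derive0.
exact: near_eq_derive.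
Qed.

Lemma near_differentiable m (W : normedModType R) (f g : 'rV[R]_m -> W) x :
  (\near x, f x = g x) -> differentiable f x -> differentiable g x.
Proof.
move=> fg df; have fgx : f x = g x := nbhs_singleton fg.
have [c e] := (diff_locallyP _ _).1 df.
suff h : g \o shift x = cst (g x) + 'd f x +o_ 0 id.
  by apply/diff_locallyP; rewrite (diff_unique c h).
apply/eqaddoP => eps eps0.
have /eqaddoP /(_ eps eps0) := e.
have {}fg : \forall z \near (0 : 'rV[R]_m), f (z + x) = g (z + x).
  by move: fg; rewrite (near_shift 0) subr0.
apply: filterS2 fg => z /= fgz; rewrite /= !fctE /= fgz fgx.
Unshelve. all: by end_near. Qed.

Lemma td_ext m (W : normedModType R) k (U : set 'rV[R]_m)
    (f g : 'rV[R]_m -> W) : open U ->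
  (forall x, U x -> f x = g x) ->
  (forall x, U x -> times_differentiable k f x) ->
  forall x, U x -> times_differentiable k g x.
Proof.
move=> oU; elim: k f g => [//|k IH] f g fg df x Ux; split.
  apply: near_differentiable (df x Ux).1; exact: near_open Ux fg.
move=> v; apply: (IH ('D_v f)) => // [y Uy|y Uy].
  by apply: near_derive; exact: near_open Uy fg.
exact: (df y Uy).2.
Qed.

Lemma td_mono m (W : normedModType R) k (f : 'rV[R]_m -> W) x :
  times_differentiable k.+1 f x -> times_differentiable k f x.
Proof.
elim: k f => [//|k IH] f [df H]; split=> // v.
exact/IH/H.
Qed.

Lemma td_cst m (W : normedModType R) k (c : W) (x : 'rV[R]_m) :
  times_differentiable k (cst c) x.
Proof.
elim: k c => [//|k IH] c; split; first exact: differentiable_cst.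
move=> v; have -> : 'D_v (cst c) = cst (0 : W) :> ('rV[R]_m -> W); last exact: IH.
by apply/funext => y; rewrite derive_cst.
Qed.

Lemma td_add m (W : normedModType R) k (U : set 'rV[R]_m)
    (f g : 'rV[R]_m -> W) : open U ->
  (forall x, U x -> times_differentiable k f x) ->
  (forall x, U x -> times_differentiable k g x) ->
  forall x, U x -> times_differentiable k (fun x => f x + g x) x.
Proof.
move=> oU; elim: k f g => [//|k IH] f g df dg x Ux; split.
  apply: differentiableD; [exact: (df x Ux).1|exact: (dg x Ux).1].
move=> v; apply: (@td_ext _ _ _ U (fun x => 'D_v f x + 'D_v g x)) => // [y Uy|].
  have [dfy _] := df y Uy; have [dgy _] := dg y Uy.
  by rewrite -deriveD //; exact: diff_derivable.
apply: IH => y Uy; [exact: (df y Uy).2|exact: (dg y Uy).2].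
Qed.

Lemma td_mul m k (U : set 'rV[R]_m) (f g : 'rV[R]_m -> R) : open U ->
  (forall x, U x -> times_differentiable k f x) ->
  (forall x, U x -> times_differentiable k g x) ->
  forall x, U x -> times_differentiable k (fun x => f x * g x) x.
Proof.
move=> oU; elim: k f g => [//|k IH] f g df dg x Ux; split.
  apply: differentiableM; [exact: (df x Ux).1|exact: (dg x Ux).1].
move=> v; apply: (@td_ext _ _ _ U
    (fun x => f x * 'D_v g x + g x * 'D_v f x)) => // [y Uy|].
  have [dfy _] := df y Uy; have [dgy _] := dg y Uy.
  rewrite (_ : (fun x => f x * g x) = f * g) // deriveM //; exact: diff_derivable.
by apply: td_add => //; apply: IH => y Uy;
  do ?[exact: td_mono (df y Uy)|exact: td_mono (dg y Uy)|exact: (df y Uy).2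
      |exact: (dg y Uy).2].
Qed.

Lemma td_sum m (W : normedModType R) k (U : set 'rV[R]_m) (I : Type) (r : seq I)
    (f : I -> 'rV[R]_m -> W) : open U ->
  (forall i x, U x -> times_differentiable k (f i) x) ->
  forall x, U x -> times_differentiable k (fun x => \sum_(i <- r) f i x) x.
Proof.
move=> oU df; elim: r => [|i r IH] x Ux.
  have -> : (fun x : 'rV[R]_m => \sum_(i <- [::]) f i x) = cst 0.
    by apply/funext => y; rewrite big_nil.
  exact: td_cst.
have -> : (fun x : 'rV[R]_m => \sum_(j <- i :: r) f j x)
   = (fun x => f i x + \sum_(j <- r) f j x).
  by apply/funext => y; rewrite big_cons.
exact: (@td_add _ _ _ U _ _ oU (df i) IH x Ux).
Qed.

Lemma differentiable_mx m p q (f : 'rV[R]_m -> 'M[R]_(p, q)) x :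
  (forall a b, differentiable (fun y => f y a b) x) -> differentiable f x.
Proof.
move=> df.
have -> : f = \sum_a \sum_b (fun y => f y a b *: delta_mx a b).
  apply/funext => y; rewrite fct_sumE {1}(matrix_sum_delta (f y)).
  by apply: eq_bigr => a _; rewrite fct_sumE.
do 2!apply: differentiable_sum => ?; exact: differentiableZl.
Qed.

Lemma differentiable_entry m p q (f : 'rV[R]_m -> 'M[R]_(p, q)) x a b :
  differentiable f x -> differentiable (fun y => f y a b) x.
Proof.
move=> df; apply: (@differentiable_comp _ _ _ _ f (fun N : 'M[R]_(p, q) => N a b)) => //.
exact: differentiable_coord.
Qed.

Lemma derive_entry m p q (f : 'rV[R]_m -> 'M[R]_(p, q)) x v a b :
  differentiable f x -> 'D_v f x a b = 'D_v (fun y => f y a b) x.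
Proof. by move=> df; rewrite derive_mx ?mxE //; exact: diff_derivable. Qed.

Lemma td_mx m p q k (U : set 'rV[R]_m) (f : 'rV[R]_m -> 'M[R]_(p, q)) :
  open U ->
  (forall x, U x -> times_differentiable k f x) <->
  (forall a b x, U x -> times_differentiable k (fun y => f y a b) x).
Proof.
move=> oU; elim: k f => [//|k IH] f; split=> [df a b x Ux|df x Ux].
  split; first exact/differentiable_entry/(df x Ux).1.
  move=> v; apply: (@td_ext _ _ _ U (fun y => 'D_v f y a b)) => // [y Uy|].
    by rewrite derive_entry //; exact: (df y Uy).1.
  by apply: (IH _).1 => y Uy; exact: (df y Uy).2.
split; first by apply: differentiable_mx => a b; exact: (df a b x Ux).1.
move=> v; apply: (IH _).2 Ux => a b.
apply: (@td_ext _ _ _ U ('D_v (fun y => f y a b))) => // [y Uy|y Uy].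
  rewrite derive_entry //; apply: differentiable_mx => c d.
  exact: (df c d y Uy).1.
exact: (df a b y Uy).2.
Qed.

Lemma derive_comp m p (g : 'rV[R]_m -> 'rV[R]_p) (f : 'rV[R]_p -> R) x v :
  differentiable g x -> differentiable f (g x) ->
  'D_v (f \o g) x = \sum_a 'D_v g x 0 a * 'D_(delta_mx 0 a) f (g x).
Proof.
move=> dg df; rewrite !deriveE //; last exact: differentiable_comp.
rewrite diff_comp //= {1}(row_sum_delta ('d g x v)) linear_sum.
by apply: eq_bigr => a _; rewrite linearZ /= deriveE.
Qed.

Lemma td_comp m p k (U : set 'rV[R]_m) (V : set 'rV[R]_p)
    (g : 'rV[R]_m -> 'rV[R]_p) (f : 'rV[R]_p -> R) : open U -> open V ->
  (forall x, U x -> V (g x)) ->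
  (forall x, U x -> times_differentiable k g x) ->
  (forall x, V x -> times_differentiable k f x) ->
  forall x, U x -> times_differentiable k (f \o g) x.
Proof.
move=> oU oV UV; elim: k f => [//|k IH] f dg df x Ux; split.
  apply: differentiable_comp; first exact: (dg x Ux).1.
  exact: (df _ (UV x Ux)).1.
move=> v; apply: (@td_ext _ _ _ U
  (fun y => \sum_a 'D_v g y 0 a * 'D_(delta_mx 0 a) f (g y))) => // [y Uy|].
  by rewrite derive_comp; [|exact: (dg y Uy).1|exact: (df _ (UV y Uy)).1].
apply: td_sum => // a; apply: td_mul => //.
  by apply: (td_mx _ _ _).1 => // y Uy; exact: (dg y Uy).2.
apply: (IH ('D_(delta_mx 0 a) f)) => y Hy; first exact: td_mono (dg y Hy).
exact: (df y Hy).2.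
Qed.

End Calculus.

(* A smooth structure is given by a smooth atlas.  The dimension may depend on
   the chart (it is locally constant), so that connected components of
   different dimensions are allowed.  [chart_inv i] is only meaningful on the
   open set [chart i @` chart_dom i]; symmetry in [i] and [j] makes the
   transition maps diffeomorphisms. *)
Record manifold (R : realType) := Manifold {
  carrier :> topologicalType;
  manifold_hausdorff : hausdorff_space carrier;
  manifold_second_countable : @second_countable carrier;
  chart_index : Type;
  chart_dim : chart_index -> nat;
  chart_dom : chart_index -> set carrier;
  chart : forall i, carrier -> 'rV[R]_(chart_dim i);
  chart_inv : forall i, 'rV[R]_(chart_dim i) -> carrier;
  chart_dom_open : forall i, open (chart_dom i);
  chart_cover : forall x, exists i, chart_dom i x;
  chart_img_open : forall i, open (chart i @` chart_dom i);
  chartK : forall i x, chart_dom i x -> chart_inv (chart i x) = x;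
  chart_continuous : forall i x,
    chart_dom i x -> {for x, continuous (chart i)};
  chart_inv_continuous : forall i y,
    (chart i @` chart_dom i) y -> {for y, continuous (@chart_inv i)};
  chart_smooth : forall i j,
    smooth_on (chart i @` (chart_dom i `&` chart_dom j))
      (chart j \o @chart_inv i)
}.

Arguments chart_index {R} M : rename.
Arguments chart_dim {R M} i : rename.
Arguments chart_dom {R M} i _ : rename.
Arguments chart {R M} i _ : rename.
Arguments chart_inv {R M} i _ : rename.
Arguments chart_dom_open {R M} i : rename.
Arguments chart_img_open {R M} i : rename.
Arguments chart_smooth {R M} i j k x _ : rename.

(* Only used for open sets [D]. *)
Definition smooth_in (R : realType) (M : manifold R) (V : normedModType R)
    (D : set M) (f : M -> V) : Prop :=
  forall i, smooth_on (chart i @` (chart_dom i `&` D)) (f \o chart_inv i).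

Section SmoothIn.
Variables (R : realType) (M : manifold R).
Implicit Types (i j : chart_index M).
Implicit Types (D : set M).

Lemma open_chart_img i D : open D -> open (chart i @` (chart_dom i `&` D)).
Proof.
move=> oD; rewrite openE => _ [x [ix Dx] <-].
have ny : (chart i @` chart_dom i) (chart i x) by exists x.
have n1 := open_nbhs_nbhs (conj (chart_img_open i) ny).
have n2 : \forall z \near chart i x, D (chart_inv i z).
  apply: (chart_inv_continuous ny); rewrite chartK //.
  exact: open_nbhs_nbhs.
apply: filterS2 n1 n2 => z [w iw <-]; rewrite chartK // => Dw.
by exists w.
Qed.
Arguments open_chart_img i [D].

Lemma smooth_in_sub (V : normedModType R) D D' (f : M -> V) :
  D' `<=` D -> smooth_in D f -> smooth_in D' f.
Proof.
by move=> DD' sf i k _ [x [ix Dx] <-]; apply: sf; exists x => //; split; auto.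
Qed.

Lemma smooth_in_local (V : normedModType R) D (f : M -> V) :
  (forall x, D x -> exists2 D', D' x & smooth_in D' f) -> smooth_in D f.
Proof.
move=> H i k _ [x [ix Dx] <-]; have [D' D'x sf] := H x Dx.
by apply: sf; exists x.
Qed.

Lemma smooth_in_ext (V : normedModType R) D (f g : M -> V) : open D ->
  (forall x, D x -> f x = g x) -> smooth_in D f -> smooth_in D g.
Proof.
move=> oD fg sf i k.
apply: (@td_ext _ _ _ _ _ (f \o chart_inv i) _ (open_chart_img i oD) _ (sf i k)).
by move=> _ [x [ix Dx] <-] /=; rewrite chartK // fg.
Qed.

Lemma smooth_in_cst (V : normedModType R) D (c : V) : smooth_in D (cst c).
Proof. by move=> i k x _; exact: td_cst. Qed.

Lemma smooth_in_add (V : normedModType R) D (f g : M -> V) : open D ->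
  smooth_in D f -> smooth_in D g -> smooth_in D (fun x => f x + g x).
Proof.
by move=> oD sf sg i k; apply: (td_add (open_chart_img i oD)); [exact: sf|exact: sg].
Qed.

Lemma smooth_in_mul D (f g : M -> R) : open D ->
  smooth_in D f -> smooth_in D g -> smooth_in D (fun x => f x * g x).
Proof.
by move=> oD sf sg i k; apply: (td_mul (open_chart_img i oD)); [exact: sf|exact: sg].
Qed.

Lemma smooth_in_sum (V : normedModType R) D (I : Type) (r : seq I)
    (f : I -> M -> V) : open D ->
  (forall c, smooth_in D (f c)) -> smooth_in D (fun x => \sum_(c <- r) f c x).
Proof.
move=> oD sf i k x Hx.
apply: (@td_sum _ _ _ _ _ _ r (fun c => f c \o chart_inv i)
  (open_chart_img i oD)) Hx => c; exact: sf.
Qed.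

Lemma smooth_in_mx p q D (f : M -> 'M[R]_(p, q)) : open D ->
  smooth_in D f <-> forall a b, smooth_in D (fun x => f x a b).
Proof.
move=> oD; split=> [sf a b i k|sf i k].
  by apply: (td_mx _ _ (open_chart_img i oD)).1; exact: sf.
by apply: (td_mx _ _ (open_chart_img i oD)).2 => a b; exact: sf.
Qed.

Lemma smooth_in_mulmx p q r D (f : M -> 'M[R]_(p, q)) (g : M -> 'M[R]_(q, r)) :
  open D -> smooth_in D f -> smooth_in D g -> smooth_in D (fun x => f x *m g x).
Proof.
move=> oD /(smooth_in_mx _ oD) sf /(smooth_in_mx _ oD) sg.
apply/(smooth_in_mx _ oD) => a b.
apply: (@smooth_in_ext _ _ (fun x => \sum_c f x a c * g x c b)) => // [x _|].
  by rewrite mxE.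
by apply: smooth_in_sum => // c; exact: smooth_in_mul.
Qed.

Lemma smooth_in_tr p q D (f : M -> 'M[R]_(p, q)) :
  open D -> smooth_in D f -> smooth_in D (fun x => (f x)^T).
Proof.
move=> oD /(smooth_in_mx _ oD) sf; apply/(smooth_in_mx _ oD) => a b.
by apply: (smooth_in_ext oD _ (sf b a)) => x _; rewrite mxE.
Qed.

Lemma smooth_in_scale p q D (f : M -> R) (g : M -> 'M[R]_(p, q)) :
  open D -> smooth_in D f -> smooth_in D g -> smooth_in D (fun x => f x *: g x).
Proof.
move=> oD sf /(smooth_in_mx _ oD) sg; apply/(smooth_in_mx _ oD) => a b.
apply: (@smooth_in_ext _ _ (fun x => f x * g x a b)) => // [x _|].
  by rewrite mxE.
exact: smooth_in_mul.
Qed.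

Lemma smooth_in_chart (i : chart_index M) : smooth_in (chart_dom i) (chart i).
Proof. by move=> j; exact: chart_smooth. Qed.

Lemma smooth_in_comp_chart (i : chart_index M) D
    (f : 'rV[R]_(chart_dim i) -> R) : open D ->
  smooth_on (chart i @` (chart_dom i `&` D)) f ->
  smooth_in (chart_dom i `&` D) (f \o chart i).
Proof.
move=> oD sf j k.
have oiD : open (chart_dom i `&` D) by apply: openI => //; exact: chart_dom_open.
apply: (@td_comp _ _ _ _ _ _ (chart i \o chart_inv j) f
  (open_chart_img j oiD) (open_chart_img i oD)) => //.
- by move=> _ [x [jx [ix Dx]] <-] /=; rewrite chartK //; exists x.
- move=> _ [x [jx [ix Dx]] <-]; apply: chart_smooth.
  by exists x.
- by move=> y; exact: sf.
Qed.

End SmoothIn.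

Arguments open_chart_img {R M} i [D].

Section Jacobian.
Variables (R : realType) (M : manifold R).

(* Row vector convention: the differential of the transition map from chart
   [i] to chart [j] at [x] sends the coordinates [v] to [v *m J]. *)
Definition chart_jacobian (i j : chart_index M) (x : M)
  : 'M[R]_(chart_dim i, chart_dim j) :=
  jacobian (chart j \o chart_inv i) (chart i x).

Lemma chart_trans_diff (i j : chart_index M) x :
  chart_dom i x -> chart_dom j x ->
  differentiable (chart j \o chart_inv i) (chart i x).
Proof.
move=> ix jx; have h : (chart i @` (chart_dom i `&` chart_dom j)) (chart i x).
  by exists x.
exact: (chart_smooth _ _ 1%N _ h).1.
Qed.

Lemma jacobian_near m p (f g : 'rV[R]_m -> 'rV[R]_p) y :
  (\near y, f y = g y) -> differentiable f y -> jacobian f y = jacobian g y.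
Proof.
move=> fg df; have dg := near_differentiable fg df.
apply/row_matrixP => a; rewrite [LHS]rowE [RHS]rowE.
have hf := deriveEjacobian (delta_mx 0 a) df.
have hg := deriveEjacobian (delta_mx 0 a) dg.
apply: etrans (esym hf) (etrans _ hg).
exact: near_derive.
Qed.

Lemma chart_jacobian_id (i : chart_index M) x :
  chart_dom i x -> chart_jacobian i i x = 1%:M.
Proof.
move=> ix; rewrite /chart_jacobian (@jacobian_near _ _ _ id); last first.
- exact: chart_trans_diff.
- apply: (near_open (chart_img_open i)); first by exists x.
  by move=> _ [z iz <-] /=; rewrite chartK.
apply/row_matrixP => a; rewrite [LHS]rowE [RHS]rowE mulmx1 /jacobian.
by rewrite mul_rV_lin1 /= diff_val.
Qed.

Lemma chart_jacobian_mul (i j k : chart_index M) x :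
  chart_dom i x -> chart_dom j x -> chart_dom k x ->
  chart_jacobian i j x *m chart_jacobian j k x = chart_jacobian i k x.
Proof.
move=> ix jx kx; rewrite /chart_jacobian.
set f := chart j \o chart_inv i; set g := chart k \o chart_inv j.
have df : differentiable f (chart i x) by exact: chart_trans_diff.
have fx : f (chart i x) = chart j x by rewrite /f /= chartK.
have dg : differentiable g (f (chart i x)) by rewrite fx; exact: chart_trans_diff.
rewrite [RHS](@jacobian_near _ _ _ (g \o f)); last first.
- exact: chart_trans_diff.
- apply: (near_open (open_chart_img i (chart_dom_open j))); first by exists x.
  by move=> _ [z [iz jz] <-]; rewrite /g /f /= !chartK.
apply/row_matrixP => a.
rewrite [LHS]rowE [RHS]rowE mulmxA /jacobian !mul_rV_lin1 /=.
by rewrite (diff_comp df dg) /= -fx.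
Qed.

Lemma smooth_in_jacobian (i j : chart_index M) :
  smooth_in (chart_dom i `&` chart_dom j) (chart_jacobian i j).
Proof.
have oD : open (chart_dom i `&` chart_dom j) by apply: openI; exact: chart_dom_open.
apply/(smooth_in_mx _ oD) => a b.
pose h y := 'D_(delta_mx 0 a) (chart j \o chart_inv i) y 0 b.
apply: (@smooth_in_ext _ _ _ _ (h \o chart i)) => // [x [ix jx]|].
  rewrite /h /= deriveEjacobian; last exact: chart_trans_diff.
  by rewrite -rowE mxE.
apply: smooth_in_comp_chart; first exact: chart_dom_open.
move=> k; apply: (td_mx _ _ (open_chart_img _ (chart_dom_open j))).1.
by move=> y Hy; apply: (chart_smooth _ _ k.+1 _ Hy).2.
Qed.

End Jacobian.

Section SmoothFunctions.
Variables (R : realType) (M : manifold R).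

(* [M] may be empty, so the ring of smooth functions may be the zero ring. *)
Definition is_Cinf : {pred (M -> R)} := mem [set f : M -> R | smooth_in setT f].

Lemma is_CinfP (f : M -> R) : f \in is_Cinf <-> smooth_in setT f.
Proof. by rewrite /is_Cinf; split=> [/set_mem|h]; [|apply/mem_set]. Qed.

Fact is_Cinf_subring : subring_closed is_Cinf.
Proof.
split=> [|f g /is_CinfP sf /is_CinfP sg|f g /is_CinfP sf /is_CinfP sg];
  apply/is_CinfP.
- exact: smooth_in_cst.
- have sm := smooth_in_mul openT (@smooth_in_cst R M _ setT (-1 : R)) sg.
  have sN : smooth_in setT (fun x => - g x).
    by apply: (smooth_in_ext openT _ sm) => x _; rewrite mulN1r.
  exact: (smooth_in_add openT sf sN).
- exact: (smooth_in_mul openT sf sg).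
Qed.

Record Cinf := MkCinf { Cinf_fun :> M -> R; _ : Cinf_fun \in is_Cinf }.

HB.instance Definition _ := [isSub for Cinf_fun].
HB.instance Definition _ := [Choice of Cinf by <:].
HB.instance Definition _ :=
  GRing.SubChoice_isSubComPzRing.Build _ _ Cinf is_Cinf_subring.

Lemma Cinf_smooth (f : Cinf) : smooth_in setT f.
Proof. by apply/is_CinfP; case: f. Qed.

Definition Cinf_cst (c : R) : Cinf :=
  MkCinf ((is_CinfP _).2 (@smooth_in_cst R M _ setT c)).

End SmoothFunctions.

(* A vector bundle is a family of vector spaces with a smooth atlas of local
   trivialisations that are linear isomorphisms on the fibres; the topology and
   smooth structure of the total space are the ones induced by this atlas.  The
   rank is locally constant.  [triv i x] and [triv_inv i x] are only meaningful
   for [x] in [triv_dom i]. *)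
Record vector_bundle (R : realType) (M : manifold R) := VectorBundle {
  fiber :> M -> lmodType R;
  triv_index : Type;
  triv_dom : triv_index -> set M;
  triv_rank : triv_index -> nat;
  triv : forall i x, {linear fiber x -> 'rV[R]_(triv_rank i)};
  triv_inv : forall i x, 'rV[R]_(triv_rank i) -> fiber x;
  triv_dom_open : forall i, open (triv_dom i);
  triv_cover : forall x, exists i, triv_dom i x;
  trivK : forall i x, triv_dom i x -> cancel (triv i x) (@triv_inv i x);
  triv_invK : forall i x, triv_dom i x -> cancel (@triv_inv i x) (triv i x);
  triv_smooth : forall i j, smooth_in (triv_dom i `&` triv_dom j)
    (fun x => lin1_mx (triv j x \o @triv_inv i x))
}.

Arguments triv_index {R M} E : rename.
Arguments triv_dom {R M E} i _ : rename.
Arguments triv_rank {R M E} i : rename.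
Arguments triv {R M E} i x : rename.
Arguments triv_inv {R M E} i x _ : rename.
Arguments triv_dom_open {R M E} i : rename.

Section Trivializations.
Variables (R : realType) (M : manifold R) (E : vector_bundle M).

Definition triv_trans (i j : triv_index E) (x : M)
  : 'M[R]_(triv_rank i, triv_rank j) := lin1_mx (triv j x \o triv_inv i x).

Lemma triv_transE (i j : triv_index E) x (v : E x) :
  triv_dom i x -> triv j x v = triv i x v *m triv_trans i j x.
Proof.
move=> ix.
have lin : linear (triv j x \o triv_inv i x).
  move=> c u w /=; rewrite -[in LHS](triv_invK ix u) -[in LHS](triv_invK ix w).
  by rewrite -linearP trivK // linearP.
pose L : {linear _ -> _} := HB.pack (triv j x \o triv_inv i x)
   (GRing.isLinear.Build _ _ _ _ _ lin).
by rewrite /triv_trans -[_ \o _]/(L : _ -> _) mul_rV_lin1 /= trivK.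
Qed.

Lemma triv_trans_id (i : triv_index E) x :
  triv_dom i x -> triv_trans i i x = 1%:M.
Proof.
move=> ix; apply/row_matrixP => a; rewrite [LHS]rowE [RHS]rowE mulmx1.
by rewrite -[in LHS](triv_invK ix (delta_mx 0 a)) -triv_transE // triv_invK.
Qed.

Lemma triv_trans_mul (i j k : triv_index E) x :
  triv_dom i x -> triv_dom j x ->
  triv_trans i j x *m triv_trans j k x = triv_trans i k x.
Proof.
move=> ix jx; apply/row_matrixP => a; rewrite [LHS]rowE [RHS]rowE mulmxA.
rewrite -(triv_invK ix (delta_mx 0 a)).
by rewrite -(triv_transE _ _ ix) -(triv_transE _ _ jx) (triv_transE _ _ ix).
Qed.

End Trivializations.

(* Transition data, from which [cocycle_bundle] builds the associated vector
   bundle: an element of the fibre at [x] is a family of components, one for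
   each index [i] whose domain contains [x], related by the transition
   matrices.  The components at the other indices carry no information and are
   set to 0. *)
Record cocycle (R : realType) (M : manifold R) := Cocycle {
  coc_index : Type;
  coc_dom : coc_index -> set M;
  coc_rank : coc_index -> nat;
  coc_trans : forall i j, M -> 'M[R]_(coc_rank i, coc_rank j);
  coc_dom_open : forall i, open (coc_dom i);
  coc_cover : forall x, exists i, coc_dom i x;
  coc_trans_id : forall i x, coc_dom i x -> coc_trans i i x = 1%:M;
  coc_trans_mul : forall i j k x, coc_dom i x -> coc_dom j x -> coc_dom k x ->
    coc_trans i j x *m coc_trans j k x = coc_trans i k x;
  coc_smooth : forall i j,
    smooth_in (coc_dom i `&` coc_dom j) (coc_trans i j)
}.

Arguments coc_index {R M} c : rename.
Arguments coc_dom {R M c} i _ : rename.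
Arguments coc_rank {R M c} i : rename.
Arguments coc_trans {R M c} i j x : rename.
Arguments coc_dom_open {R M c} i : rename.
Arguments coc_smooth {R M c} i j i0 k x _ : rename.

Section CocycleBundle.
Variables (R : realType) (M : manifold R) (c : cocycle M).

Section Fiber.
Variable (x : M).

Record coc_fiber := CocFiber {
  coc_comp : forall i : coc_index c, 'rV[R]_(coc_rank i);
  coc_compat : forall i j, coc_dom i x -> coc_dom j x ->
    coc_comp j = coc_comp i *m coc_trans i j x;
  coc_comp_out : forall i, ~ coc_dom i x -> coc_comp i = 0
}.

Lemma coc_fiberP (u v : coc_fiber) :
  (forall i, coc_dom i x -> coc_comp u i = coc_comp v i) -> u = v.
Proof.
case: u v => u u1 u2 [v v1 v2] /= uv.
have uvE : u = v.
  apply: functional_extensionality_dep => i.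
  by have [/uv //|nix] := pselect (coc_dom i x); rewrite u2 ?v2.
by subst v; congr CocFiber; exact: Prop_irrelevance.
Qed.

HB.instance Definition _ := gen_eqMixin coc_fiber.
HB.instance Definition _ := gen_choiceMixin coc_fiber.

Program Definition coc_fiber0 := @CocFiber (fun i => 0) _ _.
Next Obligation. by move=> i j _ _; rewrite mul0mx. Qed.
Next Obligation. by []. Qed.

Program Definition coc_fiberN (u : coc_fiber) :=
  @CocFiber (fun i => - coc_comp u i) _ _.
Next Obligation.
by move=> u i j ix jx /=; rewrite mulNmx -coc_compat.
Qed.
Next Obligation. by move=> u i nix /=; rewrite coc_comp_out // oppr0. Qed.

Program Definition coc_fiberD (u v : coc_fiber) :=
  @CocFiber (fun i => coc_comp u i + coc_comp v i) _ _.
Next Obligation.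
by move=> u v i j ix jx /=; rewrite mulmxDl -!coc_compat.
Qed.
Next Obligation. by move=> u v i nix /=; rewrite !coc_comp_out // addr0. Qed.

Program Definition coc_fiberZ (a : R) (u : coc_fiber) :=
  @CocFiber (fun i => a *: coc_comp u i) _ _.
Next Obligation.
by move=> a u i j ix jx /=; rewrite -scalemxAl -coc_compat.
Qed.
Next Obligation. by move=> a u i nix /=; rewrite coc_comp_out // scaler0. Qed.

Fact coc_addA : associative coc_fiberD.
Proof. by move=> u v w; apply: coc_fiberP => i _ /=; rewrite addrA. Qed.
Fact coc_addC : commutative coc_fiberD.
Proof. by move=> u v; apply: coc_fiberP => i _ /=; rewrite addrC. Qed.
Fact coc_add0 : left_id coc_fiber0 coc_fiberD.
Proof. by move=> u; apply: coc_fiberP => i _ /=; rewrite add0r. Qed.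
Fact coc_addN : left_inverse coc_fiber0 coc_fiberN coc_fiberD.
Proof. by move=> u; apply: coc_fiberP => i _ /=; rewrite addNr. Qed.

HB.instance Definition _ :=
  GRing.isZmodule.Build coc_fiber coc_addA coc_addC coc_add0 coc_addN.

Fact coc_scaleA a b u : coc_fiberZ a (coc_fiberZ b u) = coc_fiberZ (a * b) u.
Proof. by apply: coc_fiberP => i _ /=; rewrite scalerA. Qed.
Fact coc_scale1 : left_id 1 coc_fiberZ.
Proof. by move=> u; apply: coc_fiberP => i _ /=; rewrite scale1r. Qed.
Fact coc_scaleDr : right_distributive coc_fiberZ +%R.
Proof. by move=> a u v; apply: coc_fiberP => i _ /=; rewrite scalerDr. Qed.
Fact coc_scaleDl u : {morph coc_fiberZ^~ u : a b / a + b}.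
Proof. by move=> a b; apply: coc_fiberP => i _ /=; rewrite scalerDl. Qed.

HB.instance Definition _ := GRing.Zmodule_isLmodule.Build R coc_fiber
  coc_scaleA coc_scale1 coc_scaleDr coc_scaleDl.

Definition coc_comp_fun i (u : coc_fiber) := coc_comp u i.

Fact coc_comp_linear i : linear (coc_comp_fun i).
Proof. by []. Qed.

HB.instance Definition _ i :=
  GRing.isLinear.Build R coc_fiber _ _ (coc_comp_fun i) (coc_comp_linear i).

Definition coc_extend_comp i (u : 'rV[R]_(coc_rank i)) (j : coc_index c)
  : 'rV[R]_(coc_rank j) :=
  if `[< coc_dom i x /\ coc_dom j x >] then u *m coc_trans i j x else 0.

Program Definition coc_extend i (u : 'rV[R]_(coc_rank i)) : coc_fiber :=
  @CocFiber (coc_extend_comp u) _ _.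
Next Obligation.
move=> i u j k jx kx; rewrite /coc_extend_comp; have [ix|nix] := pselect (coc_dom i x).
  by rewrite !asboolT // -mulmxA coc_trans_mul.
by rewrite !asboolF ?mul0mx // => -[].
Qed.
Next Obligation.
by move=> i u j njx; rewrite /coc_extend_comp asboolF // => -[].
Qed.

Lemma coc_extendK i : coc_dom i x -> cancel (coc_comp_fun i) (@coc_extend i).
Proof.
move=> ix u; apply: coc_fiberP => j jx /=.
by rewrite /coc_extend_comp asboolT // -coc_compat.
Qed.

Lemma coc_comp_extend i : coc_dom i x -> cancel (@coc_extend i) (coc_comp_fun i).
Proof.
move=> ix u; rewrite /coc_comp_fun /= /coc_extend_comp asboolT //.
by rewrite coc_trans_id // mulmx1.
Qed.

End Fiber.

Fact coc_triv_smooth i j : smooth_in (coc_dom i `&` coc_dom j)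
  (fun x => lin1_mx (coc_comp_fun j \o @coc_extend x i)).
Proof.
apply: (smooth_in_ext _ _ (coc_smooth i j)).
  by apply: openI; exact: coc_dom_open.
move=> x [ix jx]; apply/row_matrixP => a; rewrite [LHS]rowE.
apply/rowP => b; rewrite !mxE /= /coc_comp_fun /= /coc_extend_comp asboolT //.
by rewrite mxE.
Qed.

Definition cocycle_bundle : vector_bundle M :=
  @VectorBundle R M coc_fiber (coc_index c) coc_dom coc_rank
    (fun i x => @coc_comp_fun x i) (fun i x => @coc_extend x i)
    coc_dom_open (@coc_cover _ _ c) (fun i x => @coc_extendK x i)
    (fun i x => @coc_comp_extend x i) coc_triv_smooth.

End CocycleBundle.

Section Sections.
Variables (R : realType) (M : manifold R) (E : vector_bundle M).

Record sections := Section_of {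
  section_fun :> forall x, E x;
  section_smooth : forall i : triv_index E,
    smooth_in (triv_dom i) (fun x => triv i x (section_fun x))
}.

Lemma sectionP (X Y : sections) : (forall x, X x = Y x) -> X = Y.
Proof.
case: X Y => X hX [Y hY] /= XY.
have XYE : X = Y by apply: functional_extensionality_dep.
by subst Y; congr Section_of; exact: Prop_irrelevance.
Qed.

HB.instance Definition _ := gen_eqMixin sections.
HB.instance Definition _ := gen_choiceMixin sections.

Program Definition section0 := @Section_of (fun x => 0) _.
Next Obligation.
move=> i; apply: (@smooth_in_ext _ _ _ _ (cst 0)) => [|x _|].
- exact: triv_dom_open.
- by rewrite linear0.
- exact: smooth_in_cst.
Qed.

Program Definition sectionD (X Y : sections) :=
  @Section_of (fun x => X x + Y x) _.
Next Obligation.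
move=> X Y i; have oi := triv_dom_open i.
apply: (smooth_in_ext oi _
  (smooth_in_add oi (@section_smooth X i) (@section_smooth Y i))).
by move=> x _; rewrite linearD.
Qed.

Program Definition sectionZ (f : Cinf M) (X : sections) :=
  @Section_of (fun x => f x *: X x) _.
Next Obligation.
move=> f X i; have oi := triv_dom_open i.
have sf : smooth_in (triv_dom i) f.
  exact: (smooth_in_sub (@subsetT _ _) (@Cinf_smooth _ _ f)).
apply: (smooth_in_ext oi _ (smooth_in_scale oi sf (@section_smooth X i))).
by move=> x _; rewrite linearZ.
Qed.

Fact section_addA : associative sectionD.
Proof. by move=> X Y Z; apply: sectionP => x /=; rewrite addrA. Qed.
Fact section_addC : commutative sectionD.
Proof. by move=> X Y; apply: sectionP => x /=; rewrite addrC. Qed.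
Fact section_add0 : left_id section0 sectionD.
Proof. by move=> X; apply: sectionP => x /=; rewrite add0r. Qed.
Fact section_addN : left_inverse section0 (sectionZ (-1)) sectionD.
Proof. by move=> X; apply: sectionP => x /=; rewrite scaleN1r addNr. Qed.

HB.instance Definition _ := GRing.isZmodule.Build sections
  section_addA section_addC section_add0 section_addN.

Fact section_scaleA f g X : sectionZ f (sectionZ g X) = sectionZ (f * g) X.
Proof. by apply: sectionP => x /=; rewrite scalerA. Qed.
Fact section_scale1 : left_id 1 sectionZ.
Proof. by move=> X; apply: sectionP => x /=; rewrite scale1r. Qed.
Fact section_scaleDr : right_distributive sectionZ +%R.
Proof. by move=> f X Y; apply: sectionP => x /=; rewrite scalerDr. Qed.
Fact section_scaleDl X : {morph sectionZ^~ X : f g / f + g}.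
Proof. by move=> f g; apply: sectionP => x /=; rewrite scalerDl. Qed.

HB.instance Definition _ := GRing.Zmodule_isLmodule.Build (Cinf M) sections
  section_scaleA section_scale1 section_scaleDr section_scaleDl.

End Sections.

Section Tangent.
Variables (R : realType) (M : manifold R).

Definition tangent_cocycle : cocycle M := {|
  coc_dom := @chart_dom R M;
  coc_trans := @chart_jacobian R M;
  coc_dom_open := @chart_dom_open R M;
  coc_cover := @chart_cover R M;
  coc_trans_id := @chart_jacobian_id R M;
  coc_trans_mul := @chart_jacobian_mul R M;
  coc_smooth := @smooth_in_jacobian R M |}.

(* A tangent vector is a family of components in the charts that transforms
   with the Jacobian matrices. *)
Definition tangent_bundle : vector_bundle M := cocycle_bundle tangent_cocycle.

Definition chart_at (x : M) : chart_index M := sval (cid (chart_cover x)).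

Lemma chart_atP x : chart_dom (chart_at x) x.
Proof. exact: svalP (cid (chart_cover x)). Qed.

(* Derivative of [f] along [v], computed in some chart around [x];
   [tangent_actE] shows that the choice of the chart is irrelevant. *)
Definition tangent_act (x : M) (v : tangent_bundle x) (f : M -> R) : R :=
  let i := chart_at x in
  'D_(coc_comp v i) (f \o chart_inv i) (chart i x).

Lemma tangent_actE (i : chart_index M) x (v : tangent_bundle x) (f : Cinf M) :
  chart_dom i x ->
  tangent_act v f = 'D_(coc_comp v i) (f \o chart_inv i) (chart i x).
Proof.
move=> ix; rewrite /tangent_act; set j := chart_at x.
have jx : chart_dom j x by exact: chart_atP.
have dfi k : chart_dom k x -> differentiable (f \o chart_inv k) (chart k x).
  move=> kx; apply: (Cinf_smooth f 1%N _).1.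
  by exists x.
have dt : differentiable (chart j \o chart_inv i) (chart i x).
  exact: chart_trans_diff.
have e : (chart j \o chart_inv i) (chart i x) = chart j x by rewrite /= chartK.
have dfj : differentiable (f \o chart_inv j) ((chart j \o chart_inv i) (chart i x)).
  by rewrite e; exact: dfi.
rewrite [RHS](@near_derive _ _ _ _
    ((f \o chart_inv j) \o (chart j \o chart_inv i))); last first.
  apply: (near_open (open_chart_img i (chart_dom_open j))); first by exists x.
  by move=> _ [z [iz jz] <-] /=; rewrite !chartK.
rewrite [RHS]deriveE; last exact: differentiable_comp.
rewrite (diff_comp dt dfj) /= chartK // -(deriveE _ (dfi j jx)).
have := @coc_compat _ _ _ _ v i j ix jx => ->.
by congr ('D_ _ _ _); rewrite /= /chart_jacobian -deriveEjacobian // deriveE.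
Qed.

Fact vector_field_act_smooth (V : sections tangent_bundle) (f : Cinf M) :
  (fun x => tangent_act (V x) f) \in @is_Cinf R M.
Proof.
apply/is_CinfP; apply: smooth_in_local => x _.
exists (chart_dom (chart_at x)); first exact: chart_atP.
set i := chart_at x; have oi := chart_dom_open i.
pose D a := 'D_(delta_mx 0 a) (f \o chart_inv i).
apply: (@smooth_in_ext _ _ _ _
  (fun y => \sum_a (coc_comp (V y) i 0 a * D a (chart i y)))) => // [y iy|].
  have df : differentiable (f \o chart_inv i) (chart i y).
    by apply: (Cinf_smooth f 1%N _).1; exists y.
  rewrite (tangent_actE _ _ iy) deriveE //.
  rewrite {2}(row_sum_delta (coc_comp (V y) i)) linear_sum /=.
  by apply: eq_bigr => a _; rewrite linearZ /= /D deriveE.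
apply: smooth_in_sum => // a; apply: smooth_in_mul => //.
  exact: ((smooth_in_mx _ oi).1 (@section_smooth _ _ _ V i) 0 a).
have := @smooth_in_comp_chart R M i setT (D a) openT.
rewrite setIT; apply => k y Hy.
have Hy' : (chart i @` (chart_dom i `&` setT)) y by rewrite setIT.
exact: (@Cinf_smooth _ _ f i k.+1 y Hy').2.
Qed.

Definition vector_field_act (V : sections tangent_bundle) (f : Cinf M) : Cinf M :=
  MkCinf (vector_field_act_smooth V f).

End Tangent.

Section TensorSquare.
Variables (R : realType) (M : manifold R) (E : vector_bundle M).

(* The components of a 2-tensor in a trivialisation of rank r form an r x r
   matrix A (flattened by [mxvec]), which transforms as A |-> g^T A g when the
   components of vectors transform as v |-> v g; the components of u (x) v are
   u^T v. *)
Definition tensor_trans (i j : triv_index E) (x : M)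
  : 'M[R]_(triv_rank i * triv_rank i, triv_rank j * triv_rank j) :=
  lin_mx (fun A => (triv_trans i j x)^T *m A *m triv_trans i j x).

Lemma tensor_transE (i j : triv_index E) x A :
  mxvec A *m tensor_trans i j x =
  mxvec ((triv_trans i j x)^T *m A *m triv_trans i j x).
Proof.
rewrite /tensor_trans; set T := triv_trans i j x.
rewrite -[fun _ => _]/(mulmxr T \o mulmx T^T).
by rewrite mul_vec_lin.
Qed.

Lemma tensor_trans_id (i : triv_index E) x :
  triv_dom i x -> tensor_trans i i x = 1%:M.
Proof.
move=> ix; apply/row_matrixP => a; rewrite [LHS]rowE [RHS]rowE mulmx1.
rewrite -[delta_mx 0 a]vec_mxK tensor_transE triv_trans_id //.
by rewrite trmx1 mul1mx mulmx1.
Qed.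

Lemma tensor_trans_mul (i j k : triv_index E) x :
  triv_dom i x -> triv_dom j x -> triv_dom k x ->
  tensor_trans i j x *m tensor_trans j k x = tensor_trans i k x.
Proof.
move=> ix jx kx; apply/row_matrixP => a; rewrite [LHS]rowE [RHS]rowE mulmxA.
rewrite -[delta_mx 0 a]vec_mxK !tensor_transE.
by rewrite -(triv_trans_mul k ix jx) trmx_mul !mulmxA.
Qed.

Lemma tensor_smooth (i j : triv_index E) :
  smooth_in (triv_dom i `&` triv_dom j) (tensor_trans i j).
Proof.
have oD : open (triv_dom i `&` triv_dom j).
  by apply: openI; exact: triv_dom_open.
apply/(smooth_in_mx _ oD) => a b.
pose T := triv_trans i j; have sT : smooth_in (triv_dom i `&` triv_dom j) T.
  exact: triv_smooth.
pose A : M -> 'M[R]_(triv_rank i) := cst (vec_mx (delta_mx 0 a)).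
have sA := smooth_in_mulmx oD (smooth_in_mulmx oD (smooth_in_tr oD sT)
  (@smooth_in_cst R M _ _ (vec_mx (delta_mx 0 a)))) sT.
case/mxvec_indexP: b => b1 b2.
apply: (smooth_in_ext oD _ ((smooth_in_mx _ oD).1 sA b1 b2)) => x _.
rewrite -[LHS]mxvecE -tensor_transE vec_mxK -rowE mxE //.
Qed.

Definition tensor_cocycle : cocycle M := {|
  coc_dom := @triv_dom R M E;
  coc_trans := tensor_trans;
  coc_dom_open := @triv_dom_open R M E;
  coc_cover := @triv_cover R M E;
  coc_trans_id := tensor_trans_id;
  coc_trans_mul := tensor_trans_mul;
  coc_smooth := tensor_smooth |}.

Definition tensor_square : vector_bundle M := cocycle_bundle tensor_cocycle.

Definition tensor_comp x (u v : E x) (i : triv_index E)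
  : 'rV[R]_(triv_rank i * triv_rank i) :=
  if `[< triv_dom i x >] then mxvec ((triv i x u)^T *m triv i x v) else 0.

Program Definition tensor_at x (u v : E x) : tensor_square x :=
  @CocFiber _ _ tensor_cocycle x (tensor_comp u v) _ _.
Next Obligation.
move=> x u v i j ix jx; rewrite /= /tensor_comp !asboolT // tensor_transE.
by rewrite !(triv_transE j _ ix) trmx_mul !mulmxA.
Qed.
Next Obligation. by move=> x u v i nix; rewrite /tensor_comp asboolF. Qed.

Program Definition tensor (X Y : sections E) : sections tensor_square :=
  @Section_of _ _ tensor_square (fun x => tensor_at (X x) (Y x)) _.
Next Obligation.
move=> X Y i; have oi := triv_dom_open i; apply/(smooth_in_mx _ oi) => a b.
rewrite (ord1 a); case/mxvec_indexP: b => b1 b2.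
have sX := smooth_in_tr oi (@section_smooth _ _ _ X i).
have sXY := smooth_in_mulmx oi sX (@section_smooth _ _ _ Y i).
apply: (smooth_in_ext oi _ ((smooth_in_mx _ oi).1 sXY b1 b2)) => x ix.
rewrite /= /coc_comp_fun /= /tensor_comp asboolT //.
by rewrite mxvecE.
Qed.

Lemma tensor_linearl X : linear (tensor^~ X).
Proof.
move=> f Y Z; apply: sectionP => x; apply: coc_fiberP => i ix.
rewrite /= /tensor_comp !asboolT //.
by rewrite linearP linearP /= mulmxDl linearD /= -scalemxAl linearZ.
Qed.

Lemma tensor_linearr X : linear (tensor X).
Proof.
move=> f Y Z; apply: sectionP => x; apply: coc_fiberP => i ix.
rewrite /= /tensor_comp !asboolT //.
by rewrite linearP /= mulmxDr linearD /= -scalemxAr linearZ.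
Qed.

End TensorSquare.

Record bundle_morphism (R : realType) (M : manifold R)
    (E F : vector_bundle M) := BundleMorphism {
  morphism_fun :> forall x, {linear E x -> F x};
  morphism_smooth : forall (i : triv_index E) (j : triv_index F),
    smooth_in (triv_dom i `&` triv_dom j)
      (fun x => lin1_mx (triv j x \o morphism_fun x \o triv_inv i x))
}.

Section MorphismSections.
Variables (R : realType) (M : manifold R) (E F : vector_bundle M).
Variable (a : bundle_morphism E F).

Program Definition morphism_sections (X : sections E) : sections F :=
  @Section_of _ _ F (fun x => a x (X x)) _.
Next Obligation.
move=> X j; have oj := triv_dom_open j.
apply: smooth_in_local => x jx; have [i ix] := triv_cover E x.
exists (triv_dom i `&` triv_dom j) => //.
have oij : open (triv_dom i `&` triv_dom j).
  by apply: openI => //; exact: triv_dom_open.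
have sX := smooth_in_sub (@subIsetl _ _ (triv_dom j))
  (@section_smooth _ _ _ X i).
have sa := @morphism_smooth _ _ _ _ a i j.
have sm := smooth_in_mulmx oij sX sa.
apply: (smooth_in_ext oij _ sm).
move=> y [iy jy] /=.
have lin : linear (triv j y \o a y \o triv_inv i y).
  move=> c u w /=; rewrite -[in LHS](triv_invK iy u) -[in LHS](triv_invK iy w).
  by rewrite -linearP trivK // !linearP.
pose L : {linear _ -> _} := HB.pack (triv j y \o a y \o triv_inv i y)
   (GRing.isLinear.Build _ _ _ _ _ lin).
by rewrite -[_ \o triv_inv i y]/(L : _ -> _) mul_rV_lin1 /= trivK.
Qed.

End MorphismSections.

(* [sections E] is a module over [Cinf M]; its real vector space structure is
   the one obtained through the constant functions [Cinf_cst M c]. *)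
Record leibniz_algebroid (R : realType) (M : manifold R)
    (E : vector_bundle M) := LeibnizAlgebroid {
  anchor : bundle_morphism E (tangent_bundle M);
  bracket : sections E -> sections E -> sections E;
  bracket_linearl : forall (c : R) X Y Z,
    bracket (Cinf_cst M c *: X + Y) Z =
    Cinf_cst M c *: bracket X Z + bracket Y Z;
  bracket_linearr : forall (c : R) X Y Z,
    bracket X (Cinf_cst M c *: Y + Z) =
    Cinf_cst M c *: bracket X Y + bracket X Z;
  bracket_leibniz : forall X Y Z,
    bracket X (bracket Y Z) = bracket (bracket X Y) Z + bracket Y (bracket X Z);
  bracket_anchor : forall X (f : Cinf M) Y,
    bracket X (f *: Y) =
    f *: bracket X Y + vector_field_act (morphism_sections anchor X) f *: Y
}.

Definition anchor_act (R : realType) (M : manifold R) (E : vector_bundle M)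
    (A : leibniz_algebroid E) (X : sections E) (f : Cinf M) : Cinf M :=
  vector_field_act (morphism_sections (anchor A) X) f.

Definition circ (R : realType) (M : manifold R) (E : vector_bundle M)
    (A : leibniz_algebroid E) (X Y : sections E) : sections E :=
  bracket A X Y + bracket A Y X.

Definition is_symmetric_leibniz (R : realType) (M : manifold R)
    (E : vector_bundle M) (A : leibniz_algebroid E) : Prop :=
  forall (f : Cinf M) (X Y Z : sections E),
    circ A X (f *: Y) - circ A (f *: X) Y = 0 /\
    bracket A (f *: X) (circ A Y Z) - circ A (bracket A X Y) (f *: Z)
      - circ A (f *: Y) (bracket A X Z) = 0.

(* [(D f)(X, Y)] is [loday_D f (tensor X Y)], where [tensor X Y] is the section
   of the tensor square with value X x (x) Y x at x. *)
Record loday_algebroid (R : realType) (M : manifold R)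
    (E : vector_bundle M) := LodayAlgebroid {
  loday_leibniz :> leibniz_algebroid E;
  loday_D : Cinf M -> {linear sections (tensor_square E) -> sections E};
  loday_D_linear : forall (c : R) (f g : Cinf M) T,
    loday_D (Cinf_cst M c * f + g) T =
    Cinf_cst M c *: loday_D f T + loday_D g T;
  loday_D_leibniz : forall (f g : Cinf M) T,
    loday_D (f * g) T = f *: loday_D g T + g *: loday_D f T;
  loday_bracketl : forall (f : Cinf M) X Y,
    bracket loday_leibniz (f *: X) Y =
    f *: bracket loday_leibniz X Y - anchor_act loday_leibniz Y f *: X
      + loday_D f (tensor X Y)
}.

(* Main.v *)
Require Import Defs.
From mathcomp Require Import all_boot all_order all_algebra.
From mathcomp Require Import all_classical all_reals all_analysis.
Import GRing.Theory.
Local Open Scope ring_scope.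

(** In the symmetrization of a Loday bracket the two anchor terms have opposite
    signs, so each of the two ways of putting [f] into [circ] is off from
    [C^oo(M)]-linearity by exactly one value of [D f]:
<<
      X o fY = f (X o Y) + (D f)(Y, X)      (fX) o Y = f (X o Y) + (D f)(X, Y)
>>
    ([circ_scaler], [circ_scalel]).  Hence the first axiom of a symmetric
    Leibniz algebroid measures the antisymmetric part of [D f].  In the second
    axiom, the remaining anchor term [a(Y o Z)(f) X] vanishes because [Y o Z]
    acts trivially from the left in any Leibniz algebra ([anchor_act_circ]),
    and the terms without [D f] add up to [f] times the Leibniz identity for
    [X] acting on [Y o Z].  What is left is
<<
      (D f)(X, Y o Z) - (D f)(Z, [X, Y]) - (D f)(Y, [X, Z]),
>>
    which is the second condition on [D] once [D f] is known to be symmetric. *)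

Section LeibnizAlgebroid.
Variables (R : realType) (M : manifold R) (E : vector_bundle M).
Variable A : leibniz_algebroid E.
Implicit Types (f : Cinf M) (X Y Z : sections E).

Lemma Cinf_cst1 : Cinf_cst M 1 = 1 :> Cinf M.
Proof. exact: val_inj. Qed.

Lemma bracketDl X Y Z : bracket A (X + Y) Z = bracket A X Z + bracket A Y Z.
Proof.
have := bracket_linearl A 1 X Y Z.
by rewrite Cinf_cst1 !scale1r.
Qed.

Lemma bracketDr X Y Z : bracket A X (Y + Z) = bracket A X Y + bracket A X Z.
Proof.
have := bracket_linearr A 1 X Y Z.
by rewrite Cinf_cst1 !scale1r.
Qed.

Lemma circC X Y : circ A X Y = circ A Y X.
Proof. exact: addrC. Qed.

(** By the Leibniz identity, bracketing with [[X, Y]] is the commutator of the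
    bracketings with [X] and [Y], and so is antisymmetric in [X] and [Y]. *)
Lemma bracket_circl X Y Z : bracket A (circ A X Y) Z = 0.
Proof.
have XY := bracket_leibniz A X Y Z.
have YX := bracket_leibniz A Y X Z.
rewrite XY in YX; rewrite /circ bracketDl.
apply: (addIr (bracket A Y (bracket A X Z))).
by rewrite add0r addrAC addrC -YX.
Qed.

Lemma bracket_circr X Y Z :
  bracket A X (circ A Y Z) =
  circ A (bracket A X Y) Z + circ A Y (bracket A X Z).
Proof.
rewrite /circ bracketDr !(bracket_leibniz A X) -!addrA; congr (_ + _).
by rewrite addrA addrC.
Qed.

(** Since [[X o Y, f Z]] and [f [X o Y, Z]] are both zero, so is their
    difference.  Keeping the section [Z] as a factor makes the argument purely
    algebraic: cancelling it would require sections that do not vanish at a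
    given point. *)
Lemma anchor_act_circ f X Y Z : anchor_act A (circ A X Y) f *: Z = 0.
Proof.
have := bracket_anchor A (circ A X Y) f Z.
by rewrite !bracket_circl scaler0 add0r.
Qed.

End LeibnizAlgebroid.

Section LodayAlgebroid.
Variables (R : realType) (M : manifold R) (E : vector_bundle M).
Variable L : loday_algebroid E.
Implicit Types (f : Cinf M) (X Y Z : sections E).

Lemma circ_scalel f X Y :
  circ L (f *: X) Y = f *: circ L X Y + loday_D L f (tensor X Y).
Proof.
rewrite /circ loday_bracketl bracket_anchor scalerDr -/(anchor_act L Y f).
by rewrite addrAC addrACA addNr addr0.
Qed.

Lemma circ_scaler f X Y :
  circ L X (f *: Y) = f *: circ L X Y + loday_D L f (tensor Y X).
Proof. by rewrite circC circ_scalel [in RHS]circC. Qed.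

Lemma circ_scale_defect f X Y :
  circ L X (f *: Y) - circ L (f *: X) Y =
  loday_D L f (tensor Y X) - loday_D L f (tensor X Y).
Proof. by rewrite circ_scaler circ_scalel opprD addrACA subrr add0r. Qed.

Lemma bracket_circ_scale_defect f X Y Z :
  bracket L (f *: X) (circ L Y Z) - circ L (bracket L X Y) (f *: Z)
    - circ L (f *: Y) (bracket L X Z) =
  loday_D L f (tensor X (circ L Y Z))
    - (loday_D L f (tensor Z (bracket L X Y))
       + loday_D L f (tensor Y (bracket L X Z))).
Proof.
rewrite loday_bracketl anchor_act_circ subr0 circ_scaler circ_scalel.
rewrite bracket_circr scalerDr -addrA -opprD addrACA opprD addrACA.
by rewrite subrr add0r.
Qed.

End LodayAlgebroid.

Theorem proposition3 (R : realType) (M : manifold R) (E : vector_bundle M)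
    (L : loday_algebroid E) :
  is_symmetric_leibniz L <->
  forall (f : Cinf M) (X Y Z : sections E),
    loday_D L f (tensor X Y) = loday_D L f (tensor Y X) /\
    loday_D L f (tensor X (bracket L Y Z + bracket L Z Y)) =
    loday_D L f (tensor (bracket L X Y) Z)
      + loday_D L f (tensor Y (bracket L X Z)).
Proof.
split=> [symL|symD] f X Y Z.
  have Dsym U V : loday_D L f (tensor U V) = loday_D L f (tensor V U).
    have [+ _] := symL f V U 0.
    by rewrite circ_scale_defect => /eqP; rewrite subr_eq0 => /eqP.
  split; first exact: Dsym.
  have [_ +] := symL f X Y Z.
  rewrite bracket_circ_scale_defect => /eqP; rewrite subr_eq0 => /eqP.
  by rewrite (Dsym Z).
have [Dsym _] := symD f Y X 0.
split; first by rewrite circ_scale_defect Dsym subrr.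
have [_ Dcirc] := symD f X Y Z; have [Dsym' _] := symD f Z (bracket L X Y) 0.
by rewrite bracket_circ_scale_defect Dsym' /circ Dcirc subrr.
Qed.
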